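(* Let $P$ be a polyomino, let $\mathcal{R}$ be its rook complex, and let $d$ be a positive integer. The following are equivalent: (1) $\mathcal{R}$ is pure and has dimension $d-1$; (2) $P$ admits a super partition $\mathcal{A}$ with $|\mathcal{A}|=d$.
   Context: A cell is a unit square $[a,a+(1,1)]$ with $a\in\mathbb{N}^2$; $a$ is its lower left corner. Two cells are adjacent if they share an edge. A polyomino $P$ is a nonempty finite set of cells such that any two cells of $P$ are joined by a sequence of cells of $P$ in which consecutive cells are adjacent. A cell interval of $P$ is a set of at least two consecutive cells of $P$ in one row or in one column of the grid; $\mathcal{C}$ denotes the set of all cell intervals of $P$ that are maximal with respect to inclusion. Two distinct cells of $P$ are attacking if some element of $\mathcal{C}$ contains both. The rook complex $\mathcal{R}$ of $P$ is the simplicial complex whose faces are the sets of pairwise non-attacking cells of $P$. A simplicial complex is pure if all its facets (maximal faces) have the same dimension, where $\dim F=|F|-1$; its dimension is the maximal dimension of a facet. A partition of $P$ is a nonempty subset $\mathcal{A}\subseteq\mathcal{C}$ such that distinct elements of $\mathcal{A}$ have no common cell and the union of the elements of $\mathcal{A}$ is $P$. An interval $I=\{C_1,\dots,C_m\}\in\mathcal{C}$ (with $|I|=m$) is embedded if there exists a face $F=\{D_1,\dots,D_m\}\in\mathcal{R}$ such that $C_i$ and $D_i$ are attacking for every $i\in\{1,\dots,m\}$. A partition $\mathcal{A}$ is a super partition if no interval in $\mathcal{A}$ is embedded.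
   Formalization: The polyomino P is assumed to have at least two cells; for a single cell with d = 1 the rook complex is pure of dimension 0, but there are no cell intervals and hence no partition, so the equivalence fails. *)

(* Defs.v *)
From mathcomp Require Import all_boot all_order all_algebra finmap.

Set Implicit Arguments.
Unset Strict Implicit.
Unset Printing Implicit Defensive.

Import GRing.Theory.

Local Open Scope fset_scope.

(* Simplicial complexes on finite subsets of T. The empty set is always a face *)
(* and has dimension -1, so dimensions are integers. *)
Record simplicial_complex (T : choiceType) := SimplicialComplex {
  face :> {fset T} -> Prop;
  face_fset0 : face fset0;
  face_sub : forall F G : {fset T}, face F -> G `<=` F -> face G
}.

Definition facet (T : choiceType) (K : simplicial_complex T) (F : {fset T}) : Prop :=
  K F /\ (forall G : {fset T}, K G -> F `<=` G -> G = F).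

Definition face_dim (T : choiceType) (F : {fset T}) : int := (#|` F|%:Z - 1)%R.

Definition pure (T : choiceType) (K : simplicial_complex T) : Prop :=
  forall F G : {fset T}, facet K F -> facet K G -> face_dim F = face_dim G.

Definition has_dimension (T : choiceType) (K : simplicial_complex T) (n : int) : Prop :=
  (exists F : {fset T}, facet K F /\ face_dim F = n) /\
  (forall F : {fset T}, facet K F -> (face_dim F <= n)%R).

(* The cell [a, a + (1,1)] is represented by its lower left corner a. *)
Notation cell := (nat * nat)%type.

Definition adjacent (a b : cell) : bool :=
  ((a.2 == b.2) && ((a.1.+1 == b.1) || (b.1.+1 == a.1))) ||
  ((a.1 == b.1) && ((a.2.+1 == b.2) || (b.2.+1 == a.2))).

Definition polyomino (P : {fset cell}) : Prop :=
  P != fset0 /\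
  (forall a b : cell, a \in P -> b \in P ->
     exists s : seq cell,
       [/\ {subset s <= P}, path adjacent a s & last a s = b]).

Definition row_interval (a : cell) (n : nat) : {fset cell} :=
  [fset ((a.1 + k)%N, a.2) | k in iota 0 n].

Definition col_interval (a : cell) (n : nat) : {fset cell} :=
  [fset (a.1, (a.2 + k)%N) | k in iota 0 n].

Definition cell_interval (P I : {fset cell}) : Prop :=
  I `<=` P /\
  (exists (a : cell) (n : nat),
     2 <= n /\ (I = row_interval a n \/ I = col_interval a n)).

Definition maximal_cell_interval (P I : {fset cell}) : Prop :=
  cell_interval P I /\
  (forall J : {fset cell}, cell_interval P J -> I `<=` J -> J = I).

Definition attacking (P : {fset cell}) (a b : cell) : Prop :=
  a <> b /\
  (exists I : {fset cell}, [/\ maximal_cell_interval P I, a \in I & b \in I]).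

Definition non_attacking_set (P F : {fset cell}) : Prop :=
  F `<=` P /\ {in F &, forall a b : cell, ~ attacking P a b}.

Lemma non_attacking_set0 (P : {fset cell}) : non_attacking_set P fset0.
Proof. by split=> [|a b]; rewrite ?fsub0set ?in_fset0. Qed.

Lemma non_attacking_set_sub (P F G : {fset cell}) :
  non_attacking_set P F -> G `<=` F -> non_attacking_set P G.
Proof.
move=> [FP nF] GF; split=> [|a b aG bG]; first exact: fsubset_trans FP.
exact: nF (fsubsetP GF _ aG) (fsubsetP GF _ bG).
Qed.

Definition rook_complex (P : {fset cell}) : simplicial_complex cell :=
  SimplicialComplex (non_attacking_set0 P) (@non_attacking_set_sub P).

Definition cell_partition (P : {fset cell}) (A : {fset {fset cell}}) : Prop :=
  [/\ A != fset0,
      forall I : {fset cell}, I \in A -> maximal_cell_interval P I,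
      forall I J : {fset cell}, I \in A -> J \in A -> I <> J -> I `&` J = fset0
    & \bigcup_(I <- A) I = P].

(* For I = {C_1, ..., C_m} and F = {D_1, ..., D_m}, the pairing of the two *)
(* enumerations is the bijection f : I -> F sending C_i to D_i. *)
Definition embedded (P I : {fset cell}) : Prop :=
  exists (F : {fset cell}) (f : cell -> cell),
    [/\ rook_complex P F,
        {in I &, injective f},
        F = [fset f c | c in I]
      & forall c : cell, c \in I -> attacking P c (f c)].

Definition super_partition (P : {fset cell}) (A : {fset {fset cell}}) : Prop :=
  cell_partition P A /\ (forall I : {fset cell}, I \in A -> ~ embedded P I).

(* Main.v *)
(* The maximal row and column runs of cells (single cells included) are the two    *)
(* sides of a connected bipartite graph whose edges are the cells of P; the faces  *)
(* of the rook complex are its matchings. A run is missed by some facet exactly    *)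
(* when it is embedded, so the facets meet every interval of a super partition in  *)
(* exactly one cell and have its cardinality. Conversely, suppose that all maximal *)
(* matchings have d edges. If one of them misses a run, then each parallel run     *)
(* sharing a crossing run with it is missed by some maximal matching (switch along *)
(* an alternating path, then trade one edge), and by connectedness so are all      *)
(* parallel runs. This cannot occur in both directions, for an augmenting path     *)
(* would then exist; the runs in the other direction form a super partition.       *)

From Stdlib Require Import Classical.
Require Import Defs.
From mathcomp Require Import all_boot all_order all_algebra finmap zify.

Set Implicit Arguments.
Unset Strict Implicit.
Unset Printing Implicit Defensive.

Local Open Scope fset_scope.

(** The theorem is a statement about matchings, reached through [non_attackingP] and [facetP]. From
    a super partition, [facet_embedded] forces every facet to meet every interval, and
    [super_partition_facet_card] counts. For the converse, [alternating_switch] yields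
    [avoidable_across], which spreads avoidability between parallel runs, and [not_avoidable_both],
    which forbids it at both ends of an edge; connectedness then gives [unavoidable_direction]. *)

Lemma neqb_negb (h h' : bool) : h' != h -> h' = ~~ h.
Proof. by case: h h' => [] []. Qed.

(** * Matchings of a bipartite graph *)

Section Matching.

Variables (T K : choiceType) (lab : bool -> T -> K) (P : {fset T}).
Implicit Types (F G M N Q : {fset T}) (h : bool) (a b m n : T) (v : K).

(* The elements of [P] are the edges of a bipartite graph: the edge [a] joins *)
(* the vertices [lab true a] and [lab false a] of the two sides. *)
Definition matching F : bool :=
  (F `<=` P) && [forall h, #|` lab h @` F| == #|` F|].

Definition covers F h v : bool := v \in lab h @` F.

Lemma coversP F h v : reflect (exists2 a, a \in F & v = lab h a) (covers F h v).
Proof. exact: imfsetP. Qed.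

Lemma covers_lab F h a : a \in F -> covers F h (lab h a).
Proof. by move=> aF; apply/coversP; exists a. Qed.

Lemma matchingP F :
  reflect (F `<=` P /\ forall h, {in F &, injective (lab h)}) (matching F).
Proof.
apply: (iffP andP) => [[FP /forallP lF]|[FP lF]]; split=> //.
  by move=> h; apply/card_in_imfsetP.
by apply/forallP=> h; apply/card_in_imfsetP.
Qed.

Lemma matching_inj F h a b :
  matching F -> a \in F -> b \in F -> lab h a = lab h b -> a = b.
Proof. by move=> /matchingP[_ /(_ h) lF] aF bF; apply: lF. Qed.

Lemma matchingS F G : matching G -> F `<=` G -> matching F.
Proof.
move=> /matchingP[GP lG] FG; apply/matchingP; split=> [|h a b aF bF].
  exact: fsubset_trans GP.
by apply: lG; exact: (fsubsetP FG).
Qed.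

Lemma matching1 a : a \in P -> matching [fset a].
Proof.
move=> aP; apply/matchingP; split=> [|h x y]; first by rewrite fsub1set.
by rewrite !inE => /eqP-> /eqP->.
Qed.

Lemma matching0 : matching fset0.
Proof. by apply/matchingP; split=> [|h a b]; rewrite ?fsub0set ?in_fset0. Qed.

Lemma matchingU1 F a : matching F -> a \in P ->
  (forall h, ~~ covers F h (lab h a)) -> matching (a |` F).
Proof.
move=> /matchingP[FP lF] aP uF; apply/matchingP; split=> [|h x y].
  by rewrite fsubUset fsub1set aP.
rewrite !inE => /orP[/eqP->|xF] /orP[/eqP->|yF] //; last exact: lF.
  by move=> e; have := uF h; rewrite e covers_lab.
by move=> e; have := uF h; rewrite -e covers_lab.
Qed.

Lemma matching_exchange F h m n : matching F -> n \in F -> m \in P ->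
    ~~ covers F h (lab h m) -> lab (~~ h) m = lab (~~ h) n ->
  let F' := m |` (F `\ n) in
  [/\ matching F', #|` F'| = #|` F|, ~~ covers F' h (lab h n)
    & forall v, covers F' (~~ h) v = covers F (~~ h) v].
Proof.
move=> mF nF mP uF lmn F'.
have mNF : m \notin F by apply: contra uF => /covers_lab.
have lnF h' x : x \in F -> x != n -> lab h' x != lab h' n.
  by move=> xF; apply: contra_neq; apply: matching_inj mF xF nF.
have mF' : matching F'.
  apply: matchingU1 => //; first exact: matchingS mF (fsubD1set _ _).
  move=> h'; apply/negP=> /coversP[x]; rewrite !inE => /andP[xn xF].
  have [-> e|] := eqVneq h' h; first by case/negP: uF; rewrite e covers_lab.
  by move=> /neqb_negb->; rewrite lmn => /esym e;
    have := lnF (~~ h) x xF xn; rewrite e eqxx.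
split=> //.
- by rewrite cardfsU1 (cardfsD1 n F) nF !inE (negbTE mNF) andbF.
- apply/coversP=> -[x]; rewrite !inE => /orP[/eqP->|/andP[xn xF]] e.
    by case/negP: uF; rewrite -e covers_lab.
  by have := lnF h x xF xn; rewrite e eqxx.
- move=> v; apply/coversP/coversP=> -[x xF ->].
    by move: xF; rewrite !inE => /orP[/eqP->|/andP[_ xF]]; [exists n | exists x].
  have [->|xn] := eqVneq x n; first by exists m; rewrite ?fset1U1.
  by exists x; rewrite // !inE xn xF orbT.
Qed.

(** Edges with both ends free are added greedily; each addition shrinks [P] minus [F]. *)
Lemma matching_extend F : matching F ->
  exists G, [/\ matching G, F `<=` G
    & forall a, a \in P -> (forall h, ~~ covers G h (lab h a)) -> False].
Proof.
have [k] := ubnP #|` P `\` F|; elim: k F => // k IHk F ltFk mF.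
have [/hasP[a aP /forallP uF]|/hasPn nF] :=
    boolP (has (fun a => [forall h, ~~ covers F h (lab h a)]) P); last first.
  by exists F; split=> // a /nF/negP naF uF; apply: naF; apply/forallP.
have aNF : a \notin F by apply: contraNN (uF true) => /covers_lab.
have [||G [mG FG nG]] := IHk (a |` F).
- rewrite -ltnS (leq_trans _ ltFk) // ltnS fsetUC -fsetDDl.
  by rewrite [X in _ < X](cardfsD1 a) inE aNF aP.
- exact: matchingU1.
- by exists G; split=> //; apply: fsubset_trans FG; apply: fsubsetU1.
Qed.

(** * Graphs whose maximal matchings all have [d] edges *)

Section Equimatchable.

Variable d : nat.
Hypothesis matching_le : forall F, matching F -> #|` F| <= d.
Hypothesis extend_d :
  forall F, matching F -> exists G, [/\ matching G, F `<=` G & #|` G| = d].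

(** As [d] is the maximum size of a matching, these are the inessential vertices of Gallai-Edmonds
    theory. *)
Definition avoidable h v : Prop :=
  exists F, [/\ matching F, #|` F| = d & ~~ covers F h v].

Lemma max_covers F a : matching F -> #|` F| = d -> a \in P ->
  exists h, covers F h (lab h a).
Proof.
move=> mF cF aP; apply/existsP; apply: contraT; rewrite negb_exists.
move=> /forallP uF; have := matching_le (matchingU1 mF aP uF).
rewrite cardfsU1 cF; case: (boolP (a \notin F)) => [_|]; first by rewrite ltnn.
move=> /negPn/(@covers_lab F true) cov.
by have := uF true; rewrite cov.
Qed.

(* Switching [N] along the alternating path of [M] and [N] that starts at the *)
(* vertex [v], one pair of edges at a time. The path either meets an edge of [Q], *)
(* whose end is then missed after switching [M] instead, or the new matching *)
(* still contains [Q]. *)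
Lemma alternating_switch h M N Q v :
    matching M -> #|` M| = d -> matching N -> #|` N| = d -> Q `<=` N ->
    ~~ covers M h v ->
  (exists2 q, q \in Q & avoidable h (lab h q)) \/
  (exists N', [/\ matching N' /\ #|` N'| = d, Q `|` (M `&` N) `<=` N',
                 ~~ covers N' h v
               & forall w, covers N' (~~ h) w = covers N (~~ h) w]).
Proof.
have [k] := ubnP #|` M `\` N|; elim: k M v => // k IHk M v ltMk mM cM mN cN QN uM.
have [/coversP[n nN vn]|uN] := boolP (covers N h v); last first.
  by right; exists N; split=> //; rewrite fsubUset QN fsubsetIr.
have [nQ|nNQ] := boolP (n \in Q).
  by left; exists n => //; exists M; rewrite -vn.
have nP : n \in P by case/matchingP: mN => /fsubsetP + _; apply.
rewrite vn in uM *.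
have [m mMm lnm] : exists2 m, m \in M & lab (~~ h) n = lab (~~ h) m.
  have [h'] := max_covers mM cM nP.
  have [->|] := eqVneq h' h; first by rewrite (negbTE uM).
  by move=> /neqb_negb-> /coversP.
(* Trading [m] for [n] brings [M] closer to [N] and moves the missed vertex two steps along the
   path, to [lab h m]. *)
have [mM' cM' uM' _] := matching_exchange mM mMm nP uM lnm.
have mNN : m \notin N.
  apply: contraNN uM => mNm.
  by rewrite (matching_inj mN nN mNm lnm) covers_lab.
have mP : m \in P by case/matchingP: mM => /fsubsetP + _; apply.
have [|||[N' [[mN' cN'] subN' uN' covN']]] := IHk _ _ _ mM' _ mN cN QN uM'.
- rewrite -ltnS (leq_trans _ ltMk) // ltnS.
  rewrite [X in _ < X](cardfsD1 m) inE mMm mNN /= add1n ltnS.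
  apply: fsubset_leq_card; apply/fsubsetP=> x; rewrite !inE.
  by case: eqP => [->|_] /=; [rewrite nN | case/and3P=> -> -> ->].
- by rewrite cM'.
- by left.
(* Keeping the common edges of the two matchings ensures that [n] survives in [N']; trading it for
   [m] then frees [v]. *)
right; have nN' : n \in N'.
  by apply: (fsubsetP subN'); rewrite !inE eqxx nN orbT.
have [mN2 cN2 uN2 covN2] := matching_exchange mN' nN' mP uN' (esym lnm).
exists (m |` (N' `\ n)); split=> //; first by rewrite cN2.
- apply/fsubsetP=> x; rewrite !inE => xQ.
  have xn : x != n.
    apply: contraTneq xQ => ->; rewrite (negbTE nNQ) /=.
    by apply: contraNN uM => /andP[/covers_lab].
  rewrite xn /=; apply/orP; right; apply: (fsubsetP subN'); rewrite !inE.
  case/orP: xQ => [->//|/andP[xM xN]]; rewrite xM xN andbT.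
  by apply/orP; right; apply/orP; right; rewrite andbT; apply: contraNneq mNN => <-.
- by move=> w; rewrite covN2 covN'.
Qed.

(** Take a maximum matching through [b] and switch it with [Q] equal to [{b}]: either [lab h b] is
    already avoidable, or the result misses [lab h a] and still contains [b], which can be traded
    for [a]. *)
Lemma avoidable_across h a b : a \in P -> b \in P ->
  lab (~~ h) a = lab (~~ h) b -> avoidable h (lab h a) -> avoidable h (lab h b).
Proof.
move=> aP bP lab_ab [M [mM cM uM]].
have [N [mN bN cN]] := extend_d (matching1 bP).
have [[q /fset1P->//]|] := alternating_switch mM cM mN cN bN uM.
move=> [N' [[mN' cN'] subN' uN' _]].
have bN' : b \in N' by apply: (fsubsetP subN'); rewrite !inE eqxx.
have [mN2 cN2 uN2 _] := matching_exchange mN' bN' aP uN' lab_ab.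
by exists (a |` (N' `\ b)); rewrite cN2.
Qed.

(** Switching [N] frees the [h]-end of [a] without changing the vertices covered on the other side,
    so both ends of [a] would be free in a maximum matching. *)
Lemma not_avoidable_both h a : a \in P ->
  avoidable h (lab h a) -> ~ avoidable (~~ h) (lab (~~ h) a).
Proof.
move=> aP [M [mM cM uM]] [N [mN cN uN]].
have [[q]|] := alternating_switch mM cM mN cN (fsub0set _) uM.
  by rewrite inE.
move=> [N' [[mN' cN'] _ uN' covN']].
have [h'] := max_covers mN' cN' aP.
have [->|/neqb_negb->] := eqVneq h' h; first by rewrite (negbTE uN').
by rewrite covN' (negbTE uN).
Qed.

End Equimatchable.
End Matching.

(** * Runs of cells, maximal intervals and attacking cells *)

Section Runs.

Implicit Types (h : bool) (a b c : cell) (x y k n : nat) (P F I J : {fset cell}).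

(* The direction [true] is that of the rows, [false] that of the columns. *)
Definition coord h a : nat := if h then a.1 else a.2.

Definition mkcell h x y : cell := if h then (x, y) else (y, x).

Definition line_interval h a n : {fset cell} :=
  if h then row_interval a n else col_interval a n.

(* For [a \in P], the maximal set of consecutive cells of [P] in direction [h] *)
(* that contains [a]; it may consist of [a] alone. *)
Definition run h P a : {fset cell} :=
  [fset b in P | (coord (~~ h) b == coord (~~ h) a) &&
     all (fun k => mkcell h k (coord (~~ h) a) \in P)
       (index_iota (minn (coord h a) (coord h b)) (maxn (coord h a) (coord h b)).+1)].

Lemma mkcell_coord h a : mkcell h (coord h a) (coord (~~ h) a) = a.
Proof. by case: h a => [] []. Qed.

Lemma coord_mkcell h x y : coord h (mkcell h x y) = x.
Proof. by case: h. Qed.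

Lemma coordN_mkcell h x y : coord (~~ h) (mkcell h x y) = y.
Proof. by case: h. Qed.

Lemma coord_inj h a b :
  coord h a = coord h b -> coord (~~ h) a = coord (~~ h) b -> a = b.
Proof. by rewrite -{3}(mkcell_coord h a) -{3}(mkcell_coord h b) => -> ->. Qed.

Lemma mem_line_interval h a n b : (b \in line_interval h a n) =
  (coord (~~ h) b == coord (~~ h) a) && (coord h a <= coord h b < coord h a + n).
Proof.
case: h a b => [] [a1 a2] [b1 b2]; rewrite /line_interval /coord /=;
  apply/imfsetP/andP => /= [[k]|[/eqP-> /andP[ab ba]]].
- by rewrite mem_iota => kn [-> ->]; split; lia.
- by exists (b1 - a1); [rewrite mem_iota; lia | congr pair; lia].
- by rewrite mem_iota => kn [-> ->]; split; lia.
- by exists (b2 - a2); [rewrite mem_iota; lia | congr pair; lia].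
Qed.

Lemma runP h P a b :
  reflect [/\ b \in P, coord (~~ h) b = coord (~~ h) a
            & forall k, minn (coord h a) (coord h b) <= k <=
                        maxn (coord h a) (coord h b) ->
                mkcell h k (coord (~~ h) a) \in P]
          (b \in run h P a).
Proof.
rewrite in_fset !inE /=.
apply: (iffP and3P) => [[bP /eqP ba /allP sP]|[bP /eqP ba sP]]; split=> //.
  by move=> k kab; apply: sP; rewrite mem_index_iota ltnS.
by apply/allP=> k; rewrite mem_index_iota ltnS; apply: sP.
Qed.

Lemma run_sub h P a : run h P a `<=` P.
Proof. by apply/fsubsetP=> b /runP[]. Qed.

Lemma mem_run h P a : a \in P -> a \in run h P a.
Proof.
move=> aP; apply/runP; split=> // k; rewrite minnn maxnn => kk.
by have -> : k = coord h a by [lia]; rewrite mkcell_coord.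
Qed.

Lemma run_eq h P a b : a \in P -> b \in run h P a -> run h P b = run h P a.
Proof.
move=> aP /runP[bP ba sab]; apply/fsetP=> c.
apply/runP/runP=> -[cP c_ sc]; split; rewrite ?c_ ?ba // => k kc.
  have [kab|kab] := boolP (minn (coord h a) (coord h b) <= k <=
                           maxn (coord h a) (coord h b)); first exact: sab.
  by rewrite -ba; apply: sc; lia.
have [kab|kab] := boolP (minn (coord h a) (coord h b) <= k <=
                         maxn (coord h a) (coord h b)); first exact: sab.
by apply: sc; lia.
Qed.

Lemma eq_run h P a b : b \in P -> run h P a = run h P b -> b \in run h P a.
Proof. by move=> bP ->; apply: mem_run. Qed.

Lemma run_inj h P a b : a \in P -> b \in P ->
  run h P a = run h P b -> run (~~ h) P a = run (~~ h) P b -> a = b.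
Proof.
move=> aP bP /(eq_run bP)/runP[_ e1 _] /(eq_run bP)/runP[_ e2 _].
by rewrite negbK in e2; apply: (@coord_inj h).
Qed.

Lemma sub_run h P c n b : line_interval h c n `<=` P -> b \in line_interval h c n ->
  line_interval h c n `<=` run h P b.
Proof.
move=> /fsubsetP IP bI; apply/fsubsetP=> a aI; apply/runP.
move: (aI) (bI); rewrite !mem_line_interval => /andP[/eqP ac ?] /andP[/eqP bc ?].
split=> [||k kab]; [exact: IP | by rewrite ac bc | apply: IP].
by rewrite mem_line_interval coord_mkcell coordN_mkcell bc eqxx /=; lia.
Qed.

Lemma run_line_interval h P a : a \in P ->
  exists c n, run h P a = line_interval h c n.
Proof.
move=> aP; set x := coord h a; set y := coord (~~ h) a.
pose inP k := mkcell h k y \in P.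
have xP : inP x by rewrite /inP mkcell_coord.
pose lower l := (l <= x) && all inP (index_iota l x.+1).
pose upper u := (x <= u) && all inP (index_iota x u.+1).
have inx : all inP (index_iota x x.+1).
  by apply/allP=> k; rewrite mem_index_iota => ?; have -> : k = x by lia.
have exl : exists l, lower l by exists x; rewrite /lower leqnn.
have exu : exists u, upper u by exists x; rewrite /upper leqnn.
(* Finiteness of [P] bounds the run on the right; on the left, 0 does. *)
have bndu u : upper u -> u <= \max_(b <- P) coord h b.
  move=> /andP[xu /allP uP]; have /uP uuP : u \in index_iota x u.+1.
    by rewrite mem_index_iota xu ltnSn.
  by rewrite -{1}(coord_mkcell h u y); apply: leq_bigmax_seq.
have [lo /andP[lox /allP loP] lo_min] := ex_minnP exl.
have [hi /andP[xhi /allP hiP] hi_max] := ex_maxnP exu bndu.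
exists (mkcell h lo y), (hi - lo).+1; apply/fsetP=> b.
rewrite mem_line_interval coord_mkcell coordN_mkcell.
apply/runP/andP=> [[bP /eqP-> sP]|[/eqP by_ lob]].
  have [bx|xb] := leqP (coord h b) x.
    have /lo_min : lower (coord h b); last by lia.
    rewrite /lower bx; apply/allP=> k; rewrite mem_index_iota => ?.
    by apply: sP; rewrite -/x; lia.
  have /hi_max : upper (coord h b); last by lia.
  rewrite /upper (ltnW xb); apply/allP=> k; rewrite mem_index_iota => ?.
  by apply: sP; rewrite -/x; lia.
have sP k : lo <= k <= hi -> inP k.
  move=> khi; have [kx|xk] := leqP k x.
    by apply: loP; rewrite mem_index_iota; lia.
  by apply: hiP; rewrite mem_index_iota; lia.
split=> // [|k]; last by rewrite -/x => ?; apply: sP; lia.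
by rewrite -(mkcell_coord h b) by_; apply: sP; lia.
Qed.

Lemma line_cell_interval h P c n : 2 <= n -> line_interval h c n `<=` P ->
  cell_interval P (line_interval h c n).
Proof.
by move=> n2 IP; split=> //; exists c, n; split=> //; case: h IP; [left | right].
Qed.

Lemma cell_intervalP P I : cell_interval P I ->
  exists h c n, [/\ 2 <= n, I `<=` P & I = line_interval h c n].
Proof.
by move=> [IP [c [n [n2 [e|e]]]]]; [exists true | exists false]; exists c, n.
Qed.

Lemma run_maximal h P a b : a \in P -> b \in run h P a -> b != a ->
  maximal_cell_interval P (run h P a).
Proof.
move=> aP bR ba; have aR := mem_run h aP.
have ncoord : coord h b != coord h a.
  apply: contraNneq ba => e; apply/eqP/(@coord_inj h) => //.
  by case/runP: bR.
split.
  have [c [n e]] := run_line_interval h aP.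
  have RP := run_sub h P a; rewrite e in bR aR RP *.
  apply: line_cell_interval => //.
  by move: aR bR; rewrite !mem_line_interval => /andP[_ ?] /andP[_ ?]; lia.
move=> J /cell_intervalP[h' [c [n [n2 JP eJ]]]] RJ; rewrite {}eJ in JP RJ *.
have aJ := fsubsetP RJ _ aR; have bJ := fsubsetP RJ _ bR.
have [e|/neqb_negb e] := eqVneq h' h; subst h'.
  by apply/eqP; rewrite eqEfsubset RJ andbT; apply: sub_run.
move: aJ bJ; rewrite !mem_line_interval negbK => /andP[/eqP ea _] /andP[/eqP eb _].
by rewrite ea eb eqxx in ncoord.
Qed.

Lemma maximal_run P I : maximal_cell_interval P I ->
  exists h, forall a, a \in I -> I = run h P a.
Proof.
move=> [/cell_intervalP[h [c [n [n2 IP e]]]] Imax]; exists h => a aI.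
have IR : I `<=` run h P a by rewrite e; apply: sub_run; rewrite -e.
have aP := fsubsetP IP _ aI.
have mem_I k : k < n -> mkcell h (coord h c + k) (coord (~~ h) c) \in I.
  by move=> ?; rewrite e mem_line_interval coord_mkcell coordN_mkcell eqxx /=; lia.
(* A second cell of [I]: one of its first two cells differs from [a]. *)
have [b bI ba] : exists2 b, b \in I & b != a.
  have [a0|a0] := eqVneq a (mkcell h (coord h c + 0) (coord (~~ h) c)).
    exists (mkcell h (coord h c + 1) (coord (~~ h) c)); first exact: mem_I.
    rewrite a0; apply: contra_eq_neq (coord_mkcell h (coord h c + 1) (coord (~~ h) c)).
    by move=> ->; rewrite coord_mkcell; lia.
  by exists (mkcell h (coord h c + 0) (coord (~~ h) c)); [apply: mem_I; lia | rewrite eq_sym].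
have [Rint _] := run_maximal aP (fsubsetP IR _ bI) ba.
by rewrite (Imax _ Rint IR).
Qed.

Lemma attackingP P a b : a \in P -> b \in P ->
  attacking P a b <-> a <> b /\ exists h, run h P a = run h P b.
Proof.
move=> aP bP; split=> -[ab].
  move=> [I [/maximal_run[h Ih] aI bI]]; split=> //; exists h.
  by rewrite -(Ih a) // -(Ih b).
move=> [h e]; split=> //; exists (run h P a).
have bR := eq_run bP e; split=> //; last exact: mem_run.
by apply: run_maximal bR _ => //; apply/eqP=> /esym.
Qed.

Lemma non_attackingP P F :
  non_attacking_set P F <-> matching (fun h => run h P) P F.
Proof.
split=> [[FP nF]|/matchingP[FP lF]].
  apply/matchingP; split=> // h a b aF bF e; apply/eqP/negPn/negP=> /eqP ab.
  apply: (nF a b aF bF); apply/attackingP; try exact: (fsubsetP FP).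
  by split=> //; exists h.
split=> // a b aF bF /(attackingP (fsubsetP FP _ aF) (fsubsetP FP _ bF)).
by move=> [ab [h e]]; apply/ab/(lF h).
Qed.

Lemma adjacent_run P a b : a \in P -> b \in P -> adjacent a b ->
  a != b /\ exists h, run h P a = run h P b.
Proof.
have adj h x y : mkcell h x y \in P -> mkcell h x.+1 y \in P ->
    run h P (mkcell h x y) = run h P (mkcell h x.+1 y).
  move=> xP x1P; apply/esym/run_eq => //; apply/runP.
  rewrite !coord_mkcell !coordN_mkcell; split=> // k kx.
  by have [->|->] : k = x \/ k = x.+1 by lia.
case: a b => [a1 a2] [b1 b2]; rewrite /adjacent /= => aP bP.
case/orP=> /andP[/eqP e /orP[]/eqP e']; subst; split;
  try by apply/eqP=> -[]; lia.
- by exists true; apply: (adj true).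
- by exists true; apply/esym/(adj true).
- by exists false; apply: (adj false).
- by exists false; apply/esym/(adj false).
Qed.

End Runs.

(** * Facets, embedded intervals and super partitions *)

Section RookComplex.

Implicit Types (h : bool) (a b : cell) (P F G I J : {fset cell}) (A : {fset {fset cell}}).

Lemma facetP P F : facet (rook_complex P) F <->
  matching (fun h => run h P) P F /\
  forall a, a \in P -> exists h, covers (fun h => run h P) F h (run h P a).
Proof.
split=> [[/non_attackingP mF maxF]|[mF covF]].
  split=> // a aP; apply/existsP; apply: contraT; rewrite negb_exists => /forallP uF.
  have := maxF _ ((non_attackingP _ _).2 (matchingU1 mF aP uF)) (fsubsetU1 _ _).
  move=> /fsetP/(_ a); rewrite fset1U1 => /esym.
  by move=> /(@covers_lab _ _ (fun h => run h P) F true) cov; have := uF true; rewrite cov.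
split=> [|G /non_attackingP mG FG]; first exact/non_attackingP.
apply/eqP; rewrite eqEfsubset FG andbT; apply/fsubsetP=> a aG.
have aP : a \in P by case/matchingP: mG => /fsubsetP + _; apply.
have [h /coversP[b bF ab]] := covF a aP.
by rewrite (matching_inj mG aG (fsubsetP FG _ bF) ab).
Qed.

Lemma matching_facet P F : matching (fun h => run h P) P F ->
  exists2 G, facet (rook_complex P) G & F `<=` G.
Proof.
move=> /matching_extend[G [mG FG nG]]; exists G => //; apply/facetP; split=> // a aP.
apply/existsP; apply: contraT; rewrite negb_exists => /forallP.
by move=> /(nG a aP).
Qed.

(* A facet that avoids [run h P a] covers all the crossing runs, so that *)
(* [run h P a] is embedded. *)
Lemma facet_embedded P F h a : a \in P -> facet (rook_complex P) F ->
  ~~ covers (fun h => run h P) F h (run h P a) -> embedded P (run h P a).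
Proof.
move=> aP /facetP[mF covF] uF.
have FP b : b \in F -> b \in P by case/matchingP: mF => /fsubsetP + _; apply.
(* [f c] is a cell of [F] on the run crossing at [c]; the default [c] is never reached on
   [run h P a]. *)
pose f c := head c [seq b <- F | run (~~ h) P b == run (~~ h) P c].
have fP c : c \in run h P a -> f c \in F /\ run (~~ h) P (f c) = run (~~ h) P c.
  move=> cR; have cP := fsubsetP (run_sub _ _ _) _ cR.
  have [h' /coversP[b bF cb]] := covF c cP.
  have hh' : h' = ~~ h.
    apply: neqb_negb; apply: contraNneq uF => hh'.
    by rewrite -(run_eq aP cR) -hh' cb; apply: (covers_lab (fun h => run h P)).
  have : b \in [seq b <- F | run (~~ h) P b == run (~~ h) P c].
    by rewrite mem_filter bF -hh' cb eqxx.
  rewrite /f; case E: [seq _ <- _ | _] => [//|z s] _ /=.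
  have : z \in [seq b <- F | run (~~ h) P b == run (~~ h) P c] by rewrite E mem_head.
  by rewrite mem_filter => /andP[/eqP].
exists [fset f c | c in run h P a], f; split=> //.
- apply/non_attackingP/(matchingS mF)/fsubsetP=> b /imfsetP[c /= cR ->].
  by case: (fP c cR).
- move=> c c' cR c'R e; apply: (@run_inj h P).
  + exact: fsubsetP (run_sub _ _ _) _ cR.
  + exact: fsubsetP (run_sub _ _ _) _ c'R.
  + by rewrite (run_eq aP cR) (run_eq aP c'R).
  + by have [_ <-] := fP c cR; have [_ <-] := fP c' c'R; rewrite e.
move=> c cR; have [fF fR] := fP c cR; have cP := fsubsetP (run_sub _ _ _) _ cR.
apply/attackingP => //; first exact: FP.
split; last by exists (~~ h).
move=> e; case/negP: uF; rewrite -(run_eq aP cR).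
by apply/coversP; exists (f c) => //; rewrite -e.
Qed.

Lemma embedded_missed P I : embedded P I ->
  exists2 F, rook_complex P F &
    forall G, rook_complex P G -> F `<=` G -> I `&` G = fset0.
Proof.
move=> [F [f [nF _ eF att]]]; exists F => // G [_ nG] FG; apply/eqP.
apply: contraT => /fset0Pn[c]; rewrite inE => /andP[cI cG].
have fcG : f c \in G by apply: (fsubsetP FG); rewrite eF in_imfset.
by case: (nG c (f c) cG fcG); apply: att.
Qed.

(** Sending a cell of [F] to its interval in [A] is injective since [F] is a matching, and onto
    since a missed interval would be embedded. *)
Lemma super_partition_facet_card P A F :
  super_partition P A -> facet (rook_complex P) F -> #|` F| = #|` A|.
Proof.
move=> [[_ Amax Adisj Acov] Aemb] facF; have /facetP[mF _] := facF.
have FP b : b \in F -> b \in P by case/matchingP: mF => /fsubsetP + _; apply.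
have AP I : I \in A -> I `<=` P by move=> /Amax[[]].
have Auniq I J a : I \in A -> J \in A -> a \in I -> a \in J -> I = J.
  move=> IA JA aI aJ; apply/eqP/negPn/negP=> /eqP/(Adisj I J IA JA)/fsetP/(_ a).
  by rewrite !inE aI aJ.
(* The boolean serves as a direction: the row run of [a] if it belongs to [A], else the column
   run. *)
pose g a := run (run true P a \in A) P a.
have gP a : a \in P -> g a \in A /\ a \in g a.
  move=> aP; split; last exact: mem_run.
  move: (aP); rewrite -{1}Acov => /bigfcupP[I]; rewrite andbT => IA aI.
  have [h /(_ a aI) eI] := maximal_run (Amax I IA); rewrite eI in IA.
  rewrite /g; case: (boolP (run true P a \in A)) => // nA.
  by case: h IA {eI} => // IA; rewrite IA in nA.
have <- : #|` [fset g a | a in F]| = #|` F|.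
  apply: card_in_imfset => a b /= aF bF e.
  have [gaA aga] := gP a (FP a aF); have [gbA bgb] := gP b (FP b bF).
  rewrite -e in bgb; apply: (matching_inj (h := run true P a \in A) mF aF bF).
  by rewrite (run_eq (FP a aF) bgb).
congr #|` _|; apply/fsetP=> I; apply/imfsetP/idP => [[a /= aF ->]|IA].
  by case: (gP a (FP a aF)).
have [h' Ih'] := maximal_run (Amax I IA).
have [a aI] : exists a, a \in I.
  have [[_ [c [n [n2 eI]]]] _] := Amax I IA; exists c.
  case: eI => ->.
    by rewrite (mem_line_interval true) eqxx leqnn /=; lia.
  by rewrite (mem_line_interval false) eqxx leqnn /=; lia.
have aP := fsubsetP (AP I IA) _ aI.
have [/coversP[b bF eb]|uF] := boolP (covers (fun h => run h P) F h' (run h' P a)).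
  have bI : b \in I by rewrite (Ih' a aI) eb; apply/mem_run/FP.
  by exists b => //=; have [? ?] := gP b (FP b bF); apply: (Auniq _ _ b).
by case: (Aemb I IA); rewrite (Ih' a aI); apply: facet_embedded uF.
Qed.

Lemma polyomino_connected P (Q : cell -> Prop) : polyomino P ->
    (forall a b, a \in P -> b \in P -> adjacent a b -> Q a -> Q b) ->
  forall a b, a \in P -> b \in P -> Q a -> Q b.
Proof.
move=> [_ conP] Qadj a b aP bP; have [s [sP + <-]] := conP a b aP bP.
elim: s a aP sP => //= c s IHs a aP sP /andP[ac pcs] Qa.
have cP : c \in P by apply: sP; rewrite mem_head.
apply: (IHs c) => // [x xs|]; first by apply: sP; rewrite inE xs orbT.
exact: Qadj ac Qa.
Qed.

Lemma polyomino_neighbor P a : polyomino P -> 1 < #|` P| -> a \in P ->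
  exists2 b, b \in P & adjacent a b.
Proof.
move=> [_ conP] cardP aP.
have /fset0Pn[b] : P `\ a != fset0.
  by rewrite -cardfs_gt0; move: cardP; rewrite (cardfsD1 a) aP.
rewrite !inE => /andP[ba bP]; have [[|c s] [sP]] := conP a b aP bP.
  by move=> _ /= ab; rewrite ab eqxx in ba.
by case/andP=> ac _ _; exists c => //; apply: sP; rewrite mem_head.
Qed.

(** * From purity to a super partition *)

Section Pure.

Variables (P : {fset cell}) (d : nat).
Hypotheses (polyP : polyomino P) (cardP : 1 < #|` P|).
Hypothesis facet_card : forall F, facet (rook_complex P) F -> #|` F| = d.

Local Notation lab := (fun h => run h P).

Lemma facet_max F : facet (rook_complex P) F -> matching lab P F /\ #|` F| = d.
Proof. by move=> facF; split; [case/facetP: facF | apply: facet_card]. Qed.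

Lemma extend_max F :
  matching lab P F -> exists G, [/\ matching lab P G, F `<=` G & #|` G| = d].
Proof. by move=> /matching_facet[G /facet_max[mG cG] FG]; exists G. Qed.

Lemma matching_le_max F : matching lab P F -> #|` F| <= d.
Proof. by move=> /extend_max[G [_ FG <-]]; apply: fsubset_leq_card. Qed.

Lemma avoidable_all h a b : a \in P -> b \in P ->
  avoidable lab P d h (run h P a) -> avoidable lab P d h (run h P b).
Proof.
apply: (polyomino_connected (Q := fun a => avoidable lab P d h (run h P a))) => //.
move=> {}a {}b aP bP /(adjacent_run aP bP)[_ [h' e]].
have [h'h|/neqb_negb h'h] := eqVneq h' h; subst h'; first by rewrite e.
exact: (avoidable_across matching_le_max extend_max aP bP e).
Qed.

(* By connectedness, if a row and a column are avoidable then so are all rows and *)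
(* all columns, which is impossible for the row and the column through one cell. *)
Lemma unavoidable_direction :
  exists h, forall a, a \in P -> ~ avoidable lab P d h (run h P a).
Proof.
have /fset0Pn[a aP] := polyP.1.
have [av|nav] := classic (avoidable lab P d true (run true P a)).
  exists false => b bP /(avoidable_all bP aP).
  exact: (not_avoidable_both matching_le_max aP av).
by exists true => b bP /(avoidable_all bP aP).
Qed.

Lemma super_partition_exists : exists A, super_partition P A /\ #|` A| = d.
Proof.
have [h nav] := unavoidable_direction.
have cov F a : matching lab P F -> #|` F| = d -> a \in P -> covers lab F h (run h P a).
  by move=> mF cF aP; apply/negPn/negP=> uF; apply: (nav a aP); exists F.
(* A maximum matching through a neighbour [b] of [a] covers the [h]-run of [a], but not at [a],
   which attacks [b]. So this run has a second cell. *)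
have run_max a : a \in P -> maximal_cell_interval P (run h P a).
  move=> aP; have [b bP ab] := polyomino_neighbor polyP cardP aP.
  have [neq_ab [h' e]] := adjacent_run aP bP ab.
  have [G [mG bG cG]] := extend_max (matching1 lab bP).
  have {}bG : b \in G by rewrite fsub1set in bG.
  have /coversP[c cG' eac] := cov G a mG cG aP.
  have cP : c \in P by case/matchingP: mG => /fsubsetP + _; apply.
  apply: (run_maximal aP (eq_run cP eac)); apply: contraNneq neq_ab => ca.
  by subst c; apply/eqP; apply: (matching_inj mG cG' bG e).
have AP I : I \in [fset run h P a | a in P] -> exists2 a, a \in P & I = run h P a.
  by case/imfsetP=> a; exists a.
exists [fset run h P a | a in P]; split; last first.
  (* A maximum matching has exactly one cell in each [h]-run, so there are [d] of them. *)
  have [F [mF _ cF]] := extend_max (matching0 lab P).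
  have <- : #|` [fset run h P a | a in F]| = d.
    by rewrite -cF; apply: card_in_imfset => a b; apply: matching_inj mF.
  congr #|` _|; apply/fsetP=> I; apply/imfsetP/imfsetP => /= -[a aP ->].
    by have /coversP[b] := cov F a mF cF aP; exists b.
  by exists a => //; case/matchingP: mF => /fsubsetP + _; apply.
split=> [|_ /AP[a aP ->] embI]; last first.
  (* A face witnessing embeddedness would extend to a maximum matching that misses the run. *)
  have [F /non_attackingP mF missF] := embedded_missed embI.
  have [G [mG FG cG]] := extend_max mF.
  have /coversP[b bG eab] := cov G a mG cG aP.
  have bP : b \in P by case/matchingP: mG => /fsubsetP + _; apply.
  have /fsetP/(_ b) := missF G ((non_attackingP _ _).2 mG) FG.
  by rewrite in_fsetI bG (eq_run bP eab).
split.
- by have /fset0Pn[a aP] := polyP.1; apply/fset0Pn; exists (run h P a); apply: in_imfset.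
- by move=> _ /AP[a aP ->]; apply: run_max.
- move=> _ _ /AP[a aP ->] /AP[b bP ->] neq; apply/eqP; apply: contraT => /fset0Pn[c].
  by rewrite in_fsetI => /andP[ca cb]; case: neq; rewrite -(run_eq aP ca) (run_eq bP cb).
apply/fsetP=> a; apply/bigfcupP/idP => [[_ /andP[/AP[b _ ->] _]]|aP].
  exact: (fsubsetP (run_sub _ _ _)).
by exists (run h P a); rewrite ?mem_run // in_imfset.
Qed.

End Pure.

End RookComplex.

Theorem theorem3p10 (P : {fset cell}) (hP : polyomino P) (hcard : 1 < #|` P|)
    (d : nat) (hd : 0 < d) :
  (pure (rook_complex P) /\ has_dimension (rook_complex P) (d%:Z - 1)%R) <->
  (exists A : {fset {fset cell}}, super_partition P A /\ #|` A| = d).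
Proof.
have dim_inj F n : face_dim F = (n%:Z - 1)%R -> #|` F| = n.
  by move=> /GRing.subIr[].
split=> [[pureP [[F [facF dimF]] _]]|[A [spA cA]]].
  apply: super_partition_exists => // G facG.
  by apply: dim_inj; rewrite -dimF; apply: pureP.
have facet_dim F : facet (rook_complex P) F -> face_dim F = (d%:Z - 1)%R.
  by move=> facF; rewrite /face_dim (super_partition_facet_card spA facF) cA.
split=> [F G /facet_dim-> /facet_dim-> //|]; split=> [|F /facet_dim->//].
have [F facF _] := matching_facet (matching0 (fun h => run h P) P).
by exists F; split=> //; apply: facet_dim.
Qed.
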